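(* The operad $\mathrm{ARef}$ is isomorphic to the Hadamard product $\mathbb H(\mathrm{ARAS},\mathrm{ARAS})$.
   Context: Operads: a (nonsymmetric, set) operad is a graded set $P=\bigsqcup_{n\geq1}P_n$ with maps $\circ_i:P_n\times P_m\to P_{n+m-1}$ ($1\leq i\leq n$) and a unit $\mathbf 1\in P_1$ such that for $p_1\in P_n,p_2\in P_m,p_3\in P_p$: $(p_1\circ_ip_2)\circ_{j+m-1}p_3=(p_1\circ_jp_3)\circ_ip_2$ for $1\leq i<j\leq n$; $(p_1\circ_ip_2)\circ_{i+j-1}p_3=p_1\circ_i(p_2\circ_jp_3)$ for $1\leq i\leq n$, $1\leq j\leq m$; $p_1\circ_i\mathbf 1=p_1=\mathbf 1\circ_1p_1$. Isomorphisms are arity-preserving bijections preserving unit and all partial compositions. The Hadamard product $\mathbb H(P,P')$ has as elements of arity $n$ the pairs $(p,p')\in P_n\times P'_n$, with $(p_1,p'_1)\circ_i(p_2,p'_2)=(p_1\circ_ip_2,p'_1\circ_i'p'_2)$. For $i\in\mathbb Z$, $n\geq1$ and a positive integer $x$, let $\sigma^{i,n}(x)=x$ if $x\leq i$ and $\sigma^{i,n}(x)=x+n-1$ otherwise; extend to pairs by $\sigma^{i,n}(x,y)=(\sigma^{i,n}(x),\sigma^{i,n}(y))$ and to sets of pairs elementwise. $\mathrm{ARef}$ is the operad whose elements of arity $n$ are the symbols $a_R^{(n)}$ with $R\subseteq\{(x,y):1\leq x,y\leq n+1,\ x\neq y\}$, and $\mathrm{ARAS}$ is the operad whose elements of arity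 $n$ are the symbols $a_R^{(n)}$ with $R\subseteq\{(x,y):1\leq x<y\leq n+1\}$. In both cases the partial compositions are $a_R^{(n)}\circ_ia_{R'}^{(m)}=a^{(n+m-1)}_{\sigma^{i,m}(R)\cup\sigma^{0,i}(R')}$ ($1\leq i\leq n$), and the unit is $a_\emptyset^{(1)}$. *)

(* Defs.v *)
From mathcomp Require Import all_boot all_order all_algebra.
From mathcomp Require Import finmap zify.

Set Implicit Arguments.
Unset Strict Implicit.
Unset Printing Implicit Defensive.

Local Open Scope fset_scope.

(* The graded set is the disjoint union of the [op_car n]; [op_car0] says that
   there is nothing in arity 0.  Composition indices are 1-based.  The two
   sides of an operad law have provably but not convertibly equal arities, so
   they are compared as elements of the disjoint union [{n & op_car n}]. *)
Record operad : Type := Operad {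
  op_car :> nat -> Type;
  op_car0 : op_car 0 -> False;
  op_comp : forall n m i, 0 < i <= n ->
    op_car n -> op_car m -> op_car (n + m - 1);
  op_one : op_car 1;
  op_comp_par : forall n1 n2 n3 i j
    (hi : 0 < i <= n1) (hj : 0 < j <= n1)
    (hj' : 0 < j + n2 - 1 <= n1 + n2 - 1) (hi' : 0 < i <= n1 + n3 - 1)
    (p1 : op_car n1) (p2 : op_car n2) (p3 : op_car n3), i < j ->
    existT op_car _ (op_comp hj' (op_comp hi p1 p2) p3) =
    existT op_car _ (op_comp hi' (op_comp hj p1 p3) p2);
  op_comp_seq : forall n1 n2 n3 i j
    (hi : 0 < i <= n1) (hj : 0 < j <= n2)
    (hij : 0 < i + j - 1 <= n1 + n2 - 1)
    (p1 : op_car n1) (p2 : op_car n2) (p3 : op_car n3),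
    existT op_car _ (op_comp hij (op_comp hi p1 p2) p3) =
    existT op_car _ (op_comp hi p1 (op_comp hj p2 p3));
  op_comp1r : forall n i (hi : 0 < i <= n) (p : op_car n),
    existT op_car _ (op_comp hi p op_one) = existT op_car _ p;
  op_comp1l : forall n (h1 : 0 < 1 <= 1) (p : op_car n),
    existT op_car _ (op_comp h1 op_one p) = existT op_car _ p
}.

Definition operad_isomorphic (P Q : operad) : Prop :=
  exists phi : forall n, P n -> Q n,
    [/\ forall n, bijective (phi n),
        phi 1 (op_one P) = op_one Q
      & forall n m i (hi : 0 < i <= n) (p : P n) (q : P m),
          phi (n + m - 1) (op_comp hi p q) = op_comp hi (phi n p) (phi m q)].

Section Hadamard.
Variables P Q : operad.

Definition hadamard_car (n : nat) : Type := (P n * Q n)%type.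

Definition hadamard_comp n m i (hi : 0 < i <= n)
    (a : hadamard_car n) (b : hadamard_car m) : hadamard_car (n + m - 1) :=
  (op_comp hi a.1 b.1, op_comp hi a.2 b.2).

Lemma existT_pair n n' (a : hadamard_car n) (b : hadamard_car n') :
  existT P n a.1 = existT P n' b.1 -> existT Q n a.2 = existT Q n' b.2 ->
  existT hadamard_car n a = existT hadamard_car n' b.
Proof.
move=> e1; have := congr1 (@projT1 _ _) e1; move: a b e1 => /= a b e1 en.
case: _ / en b e1 => b /(eq_from_Tagged (T_ := P)) e1.
by move=> /(eq_from_Tagged (T_ := Q)) e2; case: a b e1 e2 => ? ? [? ?] /= -> ->.
Qed.

Definition hadamard : operad.
Proof.
refine (@Operad hadamard_car _ hadamard_comp (op_one P, op_one Q) _ _ _ _).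
- by case=> /op_car0.
- by move=> *; apply: existT_pair; apply: op_comp_par.
- by move=> *; apply: existT_pair; apply: op_comp_seq.
- by move=> *; apply: existT_pair; apply: op_comp1r.
- by move=> *; apply: existT_pair; apply: op_comp1l.
Defined.

End Hadamard.

Definition sigma (i : int) (n x : nat) : nat :=
  if (x%:Z <= i)%R then x else x + n - 1.

Lemma sigmaE i n x :
  ((x%:Z <= i)%R /\ sigma i n x = x) \/
  ((i < x%:Z)%R /\ sigma i n x = x + n - 1).
Proof. by rewrite /sigma; case: ifP => ?; [left | right]; split=> //; lia. Qed.

Ltac sigma_lia :=
  repeat match goal with |- context [sigma ?i ?n ?x] =>
    move: (sigmaE i n x); move: (sigma i n x) => ? end; intros; lia.

Definition sigma2 (i : int) (n : nat) (p : nat * nat) : nat * nat :=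
  (sigma i n p.1, sigma i n p.2).

(* The symbols of arity [n] decorated by a set [R] of pairs [(x, y)] with
   [1 <= x, y <= n + 1] and [e x y]; a symbol is represented by [R]. *)
Definition symbol_ok (e : rel nat) (n : nat) (R : {fset nat * nat}) : bool :=
  (0 < n) && all (fun p : nat * nat =>
    [&& 0 < p.1 <= n.+1, 0 < p.2 <= n.+1 & e p.1 p.2]) R.

Definition symbol (e : rel nat) (n : nat) : Type :=
  {R : {fset nat * nat} | symbol_ok e n R}.

Section Symbols.
Variable e : rel nat.

Hypothesis e_sigma : forall i n x y,
  0 < n -> 0 < x -> 0 < y -> e x y -> e (sigma i n x) (sigma i n y).

Lemma symbol_comp_ok n m (i : nat) (hi : 0 < i <= n)
    (R : symbol e n) (R' : symbol e m) :
  symbol_ok e (n + m - 1) (sigma2 i m @` val R `|` sigma2 0 i @` val R').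
Proof.
case: R R' => [R /andP[n0 /allP hR]] [R' /andP[m0 /allP hR']] /=.
apply/andP; split; first by lia.
apply/allP => p; rewrite inE => /orP[] /imfsetP[q /= qR ->] /=.
- have /and3P[h1 h2 h3] := hR _ qR.
  rewrite e_sigma //; [sigma_lia | lia | lia].
- have /and3P[h1 h2 h3] := hR' _ qR.
  rewrite e_sigma //; [sigma_lia | lia ..].
Qed.

Definition symbol_comp n m i (hi : 0 < i <= n)
    (R : symbol e n) (R' : symbol e m) : symbol e (n + m - 1) :=
  exist _ (sigma2 i m @` val R `|` sigma2 0 i @` val R')
    (symbol_comp_ok hi R R').

Lemma symbol_one_ok : symbol_ok e 1 fset0.
Proof. by apply/andP; split=> //; apply/allP => p. Qed.

Definition symbol_one : symbol e 1 := exist _ fset0 symbol_one_ok.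

Lemma existT_symbol n n' (R : symbol e n) (R' : symbol e n') :
  n = n' -> val R = val R' ->
  existT (symbol e) n R = existT (symbol e) n' R'.
Proof. by move=> en; case: _ / en R' => R' /val_inj ->. Qed.

Lemma eq_imfset2 (f g : nat * nat -> nat * nat) n (R : symbol e n) :
  (forall p, 0 < p.1 <= n.+1 -> 0 < p.2 <= n.+1 -> f p = g p) ->
  f @` val R = g @` val R.
Proof.
case: R => R /= /andP[_ /allP hR] fg; apply/fsetP => p.
by apply/imfsetP/imfsetP => -[q /= qR ->]; exists q => //;
  have /and3P[? ? _] := hR _ qR; rewrite fg.
Qed.

Lemma imfset2_comp (f g : nat * nat -> nat * nat) (R : {fset nat * nat}) :
  f @` (g @` R) = (fun p => f (g p)) @` R.
Proof. exact/esym/imfset_comp. Qed.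

Lemma symbol_gt0 n (R : symbol e n) : 0 < n.
Proof. by case: R => R /andP[]. Qed.

Definition symbol_operad : operad.
Proof.
refine (@Operad (symbol e) _ symbol_comp symbol_one _ _ _ _).
- by move/symbol_gt0.
- move=> n1 n2 n3 i j hi hj hj' hi' R1 R2 R3 ij.
  have [g1 g2 g3] := And3 (symbol_gt0 R1) (symbol_gt0 R2) (symbol_gt0 R3).
  apply: existT_symbol => /=; first by lia.
  rewrite !imfsetU !imfset2_comp -!fsetUA; congr (_ `|` _).
    apply: eq_imfset2 => -[x y] /= hx hy; rewrite /sigma2 /=.
    by congr (_, _); sigma_lia.
  rewrite fsetUC; congr (_ `|` _);
    apply: eq_imfset2 => -[x y] /= hx hy; rewrite /sigma2 /=;
    by congr (_, _); sigma_lia.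
- move=> n1 n2 n3 i j hi hj hij R1 R2 R3.
  have [g1 g2 g3] := And3 (symbol_gt0 R1) (symbol_gt0 R2) (symbol_gt0 R3).
  apply: existT_symbol => /=; first by lia.
  rewrite !imfsetU !imfset2_comp -!fsetUA; congr (_ `|` (_ `|` _));
    apply: eq_imfset2 => -[x y] /= hx hy; rewrite /sigma2 /=;
    by congr (_, _); sigma_lia.
- move=> n i hi R; apply: existT_symbol => /=; first by lia.
  rewrite imfset0 fsetU0 -[RHS]imfset_id; apply: eq_imfset2 => -[x y] /= hx hy.
  by rewrite /sigma2 /=; congr (_, _); sigma_lia.
- move=> n h1 R; apply: existT_symbol => /=; first by lia.
  rewrite imfset0 fset0U -[RHS]imfset_id; apply: eq_imfset2 => -[x y] /= hx hy.
  by rewrite /sigma2 /=; congr (_, _); sigma_lia.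
Defined.

End Symbols.

Definition neqn : rel nat := fun x y => x != y.

Lemma neqn_sigma i n x y : 0 < n -> 0 < x -> 0 < y ->
  neqn x y -> neqn (sigma i n x) (sigma i n y).
Proof. by rewrite /neqn => *; sigma_lia. Qed.

Lemma ltn_sigma i n x y : 0 < n -> 0 < x -> 0 < y ->
  x < y -> sigma i n x < sigma i n y.
Proof. by move=> *; sigma_lia. Qed.

Definition ARef : operad := @symbol_operad neqn neqn_sigma.
Definition ARAS : operad := @symbol_operad ltn ltn_sigma.

(* Main.v *)
(* Since each [sigma i n] with [n > 0] is strictly increasing, a composition
   acts separately on the pairs [(x, y)] with [x < y] and on those with
   [y < x].  So a loopless relation splits into its ascending part and the
   ascending part of its converse, and this splitting is an operad morphism. *)

Require Import Defs.
From mathcomp Require Import all_boot.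
From mathcomp Require Import finmap zify.

Set Implicit Arguments.
Unset Strict Implicit.
Unset Printing Implicit Defensive.

Local Open Scope fset_scope.

Definition converse (R : {fset nat * nat}) : {fset nat * nat} :=
  [fset (p.2, p.1) | p in R].

Definition ascending (R : {fset nat * nat}) : {fset nat * nat} :=
  [fset p in R | p.1 < p.2].

Lemma in_converse R x y : ((x, y) \in converse R) = ((y, x) \in R).
Proof.
by apply/imfsetP/idP => [[[a b] /= ab [-> ->]] // | yx]; exists (y, x).
Qed.

Lemma in_ascending R p : (p \in ascending R) = (p \in R) && (p.1 < p.2).
Proof. by rewrite !inE. Qed.

Lemma converseU R R' : converse (R `|` R') = converse R `|` converse R'.
Proof. exact: imfsetU. Qed.

Lemma ascendingU R R' : ascending (R `|` R') = ascending R `|` ascending R'.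
Proof. by apply/fsetP => p; rewrite in_fsetU !in_ascending in_fsetU andb_orl. Qed.

(** [sigma2] applies the same map to both coordinates, so it commutes with the swap. *)
Lemma converse_sigma2 i n R :
  converse (sigma2 i n @` R) = sigma2 i n @` converse R.
Proof. by rewrite /converse !imfset2_comp. Qed.

(** A strictly increasing [sigma i n] both preserves and reflects [<]. Positivity of [n] matters:
    [sigma i 0] sends [i] and [i + 1] to the same value when [i] is nonnegative. *)
Lemma ascending_sigma2 i n R : 0 < n ->
  ascending (sigma2 i n @` R) = sigma2 i n @` ascending R.
Proof.
move=> n_gt0.
have sigma_mono x y : (sigma i n x < sigma i n y) = (x < y) by sigma_lia.
apply/fsetP => p; rewrite in_ascending.
apply/andP/imfsetP => [[/imfsetP[q /= qR ->]] | [q /= + ->]].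
- by rewrite /= sigma_mono => lt_q; exists q => //; rewrite /= in_ascending qR.
- by rewrite in_ascending sigma_mono => /andP[qR ->]; rewrite in_imfset.
Qed.

Lemma symbol_okP (e : rel nat) n (R : {fset nat * nat}) :
  reflect (0 < n /\ forall x y, (x, y) \in R ->
             [/\ 0 < x <= n.+1, 0 < y <= n.+1 & e x y])
          (symbol_ok e n R).
Proof.
apply: (iffP andP) => -[n_gt0 R_ok]; split=> //.
  by move=> x y xy; apply/and3P; apply: (allP R_ok (x, y)).
by apply/allP => -[x y] /R_ok[-> -> ->].
Qed.

Lemma symbol_converse_ok n (R : symbol neqn n) :
  symbol_ok neqn n (converse (val R)).
Proof.
case: R => R /= /symbol_okP[n_gt0 R_ok]; apply/symbol_okP; split=> // x y.
by rewrite in_converse /neqn eq_sym => /R_ok[].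
Qed.

Lemma symbol_ascending_ok n (R : symbol neqn n) :
  symbol_ok ltn n (ascending (val R)).
Proof.
case: R => R /= /symbol_okP[n_gt0 R_ok]; apply/symbol_okP; split=> // x y.
by rewrite in_ascending => /andP[/R_ok[]].
Qed.

Lemma symbol_merge_ok n (R R' : symbol ltn n) :
  symbol_ok neqn n (val R `|` converse (val R')).
Proof.
case: R R' => [R /= /symbol_okP[n_gt0 R_ok]] [R' /= /symbol_okP[_ R'_ok]].
apply/symbol_okP; split=> // x y; rewrite in_fsetU in_converse /neqn.
by case/orP => [/R_ok | /R'_ok] [? ?] /= ?; split=> //; lia.
Qed.

Definition symbol_converse n (R : symbol neqn n) : symbol neqn n :=
  exist _ (converse (val R)) (symbol_converse_ok R).

Definition symbol_ascending n (R : symbol neqn n) : symbol ltn n :=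
  exist _ (ascending (val R)) (symbol_ascending_ok R).

Definition symbol_split n (R : ARef n) : hadamard ARAS ARAS n :=
  (symbol_ascending R, symbol_ascending (symbol_converse R)).

Definition symbol_merge n (RR : hadamard ARAS ARAS n) : ARef n :=
  exist _ (val RR.1 `|` converse (val RR.2)) (symbol_merge_ok RR.1 RR.2).

Lemma symbol_splitK n : cancel (@symbol_split n) (@symbol_merge n).
Proof.
case=> R R_ok; apply/val_inj/fsetP => -[x y] /=.
(* The two swaps cancel, and the disjunction of [x < y] and [y < x] becomes [x != y], which
   looplessness of [R] supplies. *)
rewrite in_fsetU in_converse !in_ascending in_converse /= -andb_orr -neq_ltn.
by case: (boolP (_ \in R)) => // xy; have [_ /(_ _ _ xy)[]] := symbol_okP _ _ _ R_ok.
Qed.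

(** Pairs of [R] and [R'] ascend, so their swaps descend: filtering the union keeps exactly [R], and
    filtering its converse keeps exactly [R']. *)
Lemma symbol_mergeK n : cancel (@symbol_merge n) (@symbol_split n).
Proof.
case=> [[R R_ok] [R' R'_ok]].
have [[_ ltR] [_ ltR']] := (symbol_okP _ _ _ R_ok, symbol_okP _ _ _ R'_ok).
congr (_, _); apply/val_inj/fsetP => -[x y] /=.
- rewrite in_ascending in_fsetU in_converse /=.
  case: (boolP ((x, y) \in R)) => [/ltR[_ _ /= ->] // | _] /=.
  by apply/andP => -[/ltR'[_ _ /=]]; lia.
(* Under the converse, [R'] is the component read unswapped; [orbC] puts it first, as [R] was
   above. *)
- rewrite in_ascending in_converse in_fsetU in_converse /= orbC.
  case: (boolP ((x, y) \in R')) => [/ltR'[_ _ /= ->] // | _] /=.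
  by apply/andP => -[/ltR[_ _ /=]]; lia.
Qed.

Theorem proposition8 : operad_isomorphic ARef (hadamard ARAS ARAS).
Proof.
exists symbol_split; split.
- move=> n; exact: Bijective (@symbol_splitK n) (@symbol_mergeK n).
- by congr (_, _); apply/val_inj/fsetP => p;
    rewrite /= ?/converse ?imfset0 in_ascending !inE.
(* A composition shifts by [sigma2 i m] and [sigma2 0 i], so monotonicity requires both [m] and [i]
   to be positive: [m] as the arity of a symbol, [i] as a 1-based index. *)
- move=> n m i hi R R'; have m_gt0 := symbol_gt0 R'.
  have i_gt0 : 0 < i by case/andP: hi.
  congr (_, _); apply: val_inj.
    by rewrite /= ascendingU !ascending_sigma2.
  by rewrite /= converseU ascendingU !converse_sigma2 !ascending_sigma2.
Qed.
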